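(* Let $m\ge n$ be positive integers and let $G$ be a non-chordal graph that does not contain $I_m\vee K_n$ as a subgraph and satisfies $\omega(G[\Omega(G)])+i(G)\le m$. Then $G$ has a chordal completion $G^*$ (a chordal spanning supergraph) with $\omega(G^* )<m+n$. Consequently $\chi_{DP}(G)<m+n$.
   Context: All graphs are finite and simple; $\omega$ is the clique number, $\chi_{DP}$ the DP-chromatic number, $I_m$ the edgeless graph on $m$ vertices, and $G_1\vee G_2$ the join (disjoint union plus all edges between $V(G_1)$ and $V(G_2)$). A hole of $G$ is an induced cycle of length at least $4$; $G$ is chordal if it has no hole. $\mathcal H(G)$ is the set of holes, $\mathcal H(G,u)$ those containing $u$, and $\Omega(G)=\bigcup_{H\in\mathcal H(G)}V(H)$. A hole cover of $G$ is a nonempty $X\subseteq V(G)$ meeting every hole (any nonempty set if $G$ is chordal). A vertex $u$ satisfies the NC property in $G$ if there are no holes $H\in\mathcal H(G,u)$, $H'\in\mathcal H(G)\setminus\mathcal H(G,u)$ sharing two consecutive edges (two distinct edges with a common end vertex lying on both). A set $\mathcal C$ satisfies the NC property in $G$ if each of its vertices does and every hole contains at most one vertex of $\mathcal C$. Locally chordalizing all holes in $\mathcal H(G,u)$ by $u$ means adding all edges $uw$ with $w\ne u$ lying on some hole in $\mathcal H(G,u)$. For a hole cover $\mathcal C=\{u_1,\dots,u_k\}$ satisfying the NC property in $G$, set $G_0=G$, obtain $G_i$ from $G_{i-1}$ by locally chordalizing all holes in $\mathcal H(G_{i-1},u_i)$ by $u_i$, and put $\widehat G(\mathcal C)=G_k$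 (independent of the ordering). Given a hole cover $\mathcal C$ of $G$, an ordered partition $(\mathcal C_1,\dots,\mathcal C_\ell)$ of $\mathcal C$ into nonempty parts is a local chordalization partition if, with $G_0=G_0^*=G-\mathcal C$ and, for $i=1,\dots,\ell$, $G_i$ the graph with $V(G_i)=V(G_{i-1}^* )\cup\mathcal C_i$ and $E(G_i)=E(G_{i-1}^* )\cup E\big(G-\bigcup_{j=i+1}^{\ell}\mathcal C_j\big)$ and $G_i^*=\widehat{G_i}(\mathcal C_i)$, each $\mathcal C_i$ is a hole cover of $G_i$ satisfying the NC property in $G_i$ and each $G_i^*$ is chordal. The non-chordality index $i(G)$ is $0$ if $G$ is chordal and otherwise the smallest $\ell$ such that some hole cover of $G$ admits a local chordalization partition with $\ell$ parts. *)

(* Defs.v *)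
From Stdlib Require Import ClassicalEpsilon.
From mathcomp Require Import all_boot.
Set Implicit Arguments. Unset Strict Implicit. Unset Printing Implicit Defensive.

Definition asbool (P : Prop) : bool :=
  if excluded_middle_informative P then true else false.

(* A finite simple graph on an ambient finite type T: a vertex set and a
   raw relation; the actual adjacency [adj] symmetrizes the relation, removes
   loops and restricts it to the vertex set, so every record is a simple graph. *)
Record graph (T : finType) := Graph { gV : {set T}; gE : rel T }.

Section Graphs.
Variable T : finType.
Implicit Types (G : graph T) (X C H : {set T}) (u v w x y : T).

Definition adj G x y : bool :=
  [&& x \in gV G, y \in gV G, x != y & gE G x y || gE G y x].

Definition induced G X : graph T := Graph (X :&: gV G) (adj G).
Definition delete G X : graph T := induced G (gV G :\: X).

Definition clique G (K : {set T}) : bool :=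
  (K \subset gV G) && [forall x in K, forall y in K, (x != y) ==> adj G x y].
Definition omega G : nat := \max_(K : {set T} | clique G K) #|K|.

Definition is_hole G X : Prop :=
  exists s : seq T,
    [/\ uniq s, 4 <= size s, X = [set x in s], {subset s <= gV G} &
        {in s &, forall x y,
           adj G x y = (index y s == (index x s).+1 %% size s)
                    || (index x s == (index y s).+1 %% size s)}].

Definition chordal G : Prop := forall X, ~ is_hole G X.

Definition Omega G : {set T} :=
  [set x | asbool (exists X, is_hole G X /\ x \in X)].

Definition hole_cover G X : Prop :=
  [/\ X \subset gV G, X != set0 & forall H, is_hole G H -> H :&: X != set0].

Definition NC_vertex G u : Prop :=
  ~ (exists H H' a b c,
       [/\ is_hole G H, u \in H, is_hole G H' & u \notin H'] /\
       [/\ a != c, adj G a b, adj G b c,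
           [/\ a \in H, b \in H & c \in H] & [/\ a \in H', b \in H' & c \in H']]).

Definition NC_set G C : Prop :=
  (forall u, u \in C -> NC_vertex G u) /\
  (forall H, is_hole G H -> #|H :&: C| <= 1).

Definition on_hole_with G u w : bool :=
  (w != u) && asbool (exists H, [/\ is_hole G H, u \in H & w \in H]).
Definition local_chordalize G u : graph T :=
  Graph (gV G) (fun x y => adj G x y || ((x == u) && on_hole_with G u y)).

Definition hatG G C : graph T := foldl local_chordalize G (enum C).

(* checking the conditions of a local chordalization partition:
   G is the original graph, Gs = G^*_{i-1}, parts = (C_i, ..., C_l) *)
Fixpoint lcp_ok G (Gs : graph T) (parts : seq {set T}) : Prop :=
  match parts with
  | [::] => True
  | Ci :: rest =>
      let Gi := Graph (gV Gs :|: Ci)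
                  (fun x y => adj Gs x y ||
                              adj (delete G (\bigcup_(D <- rest) D)) x y) in
      [/\ hole_cover Gi Ci, NC_set Gi Ci, chordal (hatG Gi Ci)
        & lcp_ok G (hatG Gi Ci) rest]
  end.

Definition ordered_partition C (P : seq {set T}) : Prop :=
  [/\ all (fun D => D != set0) P, \bigcup_(D <- P) D = C &
      forall i j, i < j < size P -> [disjoint nth set0 P i & nth set0 P j]].

Definition lc_partition G C (P : seq {set T}) : Prop :=
  ordered_partition C P /\ lcp_ok G (delete G C) P.

Definition has_lcp G (l : nat) : Prop :=
  exists C, hole_cover G C /\ exists P, size P = l /\ lc_partition G C P.

Definition nci G (k : nat) : Prop :=
  (chordal G /\ k = 0) \/
  [/\ ~ chordal G, has_lcp G k & forall l, has_lcp G l -> k <= l].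

Definition chordal_completion G (Gs : graph T) : Prop :=
  [/\ gV Gs = gV G, (forall x y, adj G x y -> adj Gs x y) & chordal Gs].

Definition contains_subgraph (S : finType) G (HE : rel S) : Prop :=
  exists f : S -> T, [/\ injective f, forall s, f s \in gV G &
                        forall s t, HE s t -> adj G (f s) (f t)].

(* DP-colouring.  A k-fold cover assigns to every ordered pair (u,v) a relation
   M u v on colours {0..k-1}, symmetric (M u v a b = M v u b a) and, for every
   edge uv, a matching between the lists {u} x [k] and {v} x [k]. *)
Definition dp_cover G (k : nat) (M : T -> T -> nat -> nat -> bool) : Prop :=
  (forall u v a b, M u v a b = M v u b a) /\
  (forall u v a b b', adj G u v -> a < k -> b < k -> b' < k ->
       M u v a b -> M u v a b' -> b = b').

Definition dp_colorable G (k : nat) : Prop :=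
  forall M, dp_cover G k M ->
    exists f : T -> nat,
      (forall v, v \in gV G -> f v < k) /\
      (forall u v, adj G u v -> ~~ M u v (f u) (f v)).

Definition chiDP G (k : nat) : Prop :=
  dp_colorable G k /\ forall j, dp_colorable G j -> k <= j.

End Graphs.

Definition join_IK (m n : nat) : rel ('I_m + 'I_n)%type :=
  fun x y => match x, y with
             | inl _, inr _ | inr _, inl _ => true
             | inr i, inr j => i != j
             | inl _, inl _ => false
             end.
Arguments join_IK : clear implicits.

(* Main.v *)
(* Let G* be the final graph of a local chordalization partition with i(G) parts.
   (1) If u satisfies NC, chordalizing by u destroys exactly the holes through u;
       hence the edges added at one step are the pairs (u, w) with u in the current
       part and w on a common hole with u in the graph before the step.
   (2) Inside a clique of the new graph any two such edges meet (two disjoint ones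
       close up to a 4-hole with two vertices of the part), so all of them share a
       vertex: removing it gives a clique of the previous graph.  A clique of G*
       becomes a clique of G after removing at most i(G) vertices.
   (3) A vertex outside Omega(G) never gets a new edge, because the neighbourhood of
       every component of G - N[x] is a clique when x lies on no hole.
   By (2), a clique K of G* has at most omega(G[Omega(G)]) + i(G) <= m vertices in
   Omega(G); if |K| >= m + n, then n further vertices of K are, by (3), joined in G to
   all of K, which gives a copy of I_m v K_n.  The bound on the DP-chromatic number
   follows by greedy colouring along simplicial vertices. *)
Require Import Defs.
From mathcomp Require Import all_boot.
From mathcomp Require Import zify.
Set Implicit Arguments. Unset Strict Implicit. Unset Printing Implicit Defensive.

Lemma asboolP (P : Prop) : reflect P (asbool P).
Proof.
by rewrite /asbool; case: ClassicalEpsilon.excluded_middle_informative; constructor.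
Qed.

(* Boolean hypotheses that [lia] cannot interpret make its preprocessing
   exponential. *)
Ltac arith :=
  repeat match goal with
  | H : is_true (_ \in _) |- _ => clear H
  | H : is_true (uniq _) |- _ => clear H
  | H : is_true (~~ _) |- _ => clear H
  | H : is_true (adj _ _ _) |- _ => clear H
  | H : is_true (path _ _ _) |- _ => clear H
  end; lia.

Section Graphs.
Variable T : finType.
Implicit Types (G : graph T) (A B C D H K Q S W X Y Z : {set T}) (s : seq T).
Implicit Types (a b c d u v w x y z : T).

Lemma adjC G x y : adj G x y = adj G y x.
Proof. by rewrite /adj eq_sym orbC; do !bool_congr. Qed.

Lemma adjxx G x : adj G x x = false.
Proof. by rewrite /adj eqxx !andbF. Qed.

Lemma adjE (V : {set T}) (e : rel T) x y : adj (Graph V e) x y =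
  [&& x \in V, y \in V, x != y & e x y || e y x].
Proof. by []. Qed.

Lemma adj_neq G x y : adj G x y -> x != y.
Proof. by case/and4P. Qed.

Lemma adj_gV G x y : adj G x y -> (x \in gV G) * (y \in gV G).
Proof. by case/and4P=> -> ->. Qed.

Lemma eq_graph_hole G1 G2 X :
  X \subset gV G2 -> {in X &, forall x y, adj G1 x y = adj G2 x y} ->
  is_hole G1 X -> is_hole G2 X.
Proof.
move=> /subsetP sX eqA [s [us ss eX sV adjs]]; exists s; split=> //.
  by move=> x xs; apply: sX; rewrite eX inE.
by move=> x y xs ys; rewrite -eqA ?eX ?inE //; apply: adjs.
Qed.

(** * Holes as indexed cycles *)

(** Ordering the positions as [i < j] removes the modulus of [is_hole]: the only pair joined around
    the end of the list is the first with the last. *)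
Definition hole_seq G s : Prop :=
  [/\ uniq s, 4 <= size s, {subset s <= gV G} & forall x0 i j, i < j < size s ->
      adj G (nth x0 s i) (nth x0 s j) =
      (j == i.+1) || (i == 0) && (j == (size s).-1)].

Lemma succ_mod n i : i < n -> i.+1 %% n = if i.+1 == n then 0 else i.+1.
Proof. by move=> ?; case: eqP => [<-|?]; rewrite ?modnn ?modn_small //; lia. Qed.

Lemma hole_of_seq G s : hole_seq G s -> is_hole G [set x in s].
Proof.
case=> us ss sV adjs; exists s; split=> //.
move=> x y xs ys.
wlog le : x y xs ys / index x s <= index y s.
  move=> h; case: (leqP (index x s) (index y s)) => [|/ltnW] l; first exact: h.
  by rewrite adjC h // orbC.
have ix : index x s < size s by rewrite index_mem.
have iy : index y s < size s by rewrite index_mem.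
rewrite !succ_mod //.
case: (eqVneq (index x s) (index y s)) => [e|ne].
  have -> : y = x by rewrite -(nth_index x ys) -e nth_index.
  by rewrite adjxx; case: (_.+1 =P size s) => ?; lia.
rewrite -{1}(nth_index x xs) -{1}(nth_index x ys) adjs; last by lia.
by do 2 case: (_.+1 =P size s) => ?; lia.
Qed.

Lemma next_index s x y : uniq s -> x \in s -> y \in s ->
  (next s x == y) = (index y s == (index x s).+1 %% size s).
Proof.
case: s => // x0 t us xs ys; rewrite next_nth xs.
have ix : index x (x0 :: t) < size (x0 :: t) by rewrite index_mem.
rewrite succ_mod //.
case: (eqVneq (index x (x0 :: t)).+1 (size (x0 :: t))) => e.
  rewrite nth_default; last by move: e; set k := index x _ => -[->].
  by rewrite /=; case: eqP.
have l : (index x (x0 :: t)).+1 < size (x0 :: t) by lia.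
rewrite -[nth x0 t _]/(nth x0 (x0 :: t) (index x (x0 :: t)).+1).
by apply/eqP/eqP => <-; rewrite ?index_uniq ?nth_index.
Qed.

(** A rotation brings [u] to position 0, so that distances along the hole are measured from [u]. *)
Lemma hole_seq_of G X u : is_hole G X -> u \in X ->
  exists s, [/\ hole_seq G s, u \in s, index u s = 0 & X = [set x in s]].
Proof.
case=> s [us ss eX sV adjs]; rewrite eX inE => us'.
case: (rot_to us') => k t e; exists (u :: t).
have memE : u :: t =i s by move=> x; rewrite -e mem_rot.
have ut : uniq (u :: t) by rewrite -e rot_uniq.
have sz : size (u :: t) = size s by rewrite -e size_rot.
split; rewrite /= ?eqxx ?mem_head //; last by apply/setP=> x; rewrite inE [RHS]inE -memE.
split=> //; first by rewrite sz.
  by move=> x; rewrite memE; apply: sV.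
move=> x0 i j ij; have [lij lj] := andP ij; have li := ltn_trans lij lj.
have mi : nth x0 (u :: t) i \in u :: t by apply: mem_nth.
have mj : nth x0 (u :: t) j \in u :: t by apply: mem_nth.
rewrite adjs -?memE // -!next_index -?memE //.
(* The cyclic successor [next] is invariant under rotation, whereas indices are not; hence the
   detour through it. *)
rewrite -!(next_rot k us) e !next_index // !index_uniq // !succ_mod //.
by rewrite sz in ij *; do 2 case: (_.+1 =P size s) => ?; lia.
Qed.

(** * Holes through connected sets *)

Definition inner G S : rel T := [rel x y | [&& x \in S, y \in S & adj G x y]].
Definition conn_set G S : Prop := {in S &, forall x y, connect (inner G S) x y}.
(** Equality is allowed, so the negation says that the two sets are disjoint and have no edge
    between them. *)
Definition touch G A B : Prop :=
  exists x y, [/\ x \in A, y \in B & (x == y) || adj G x y].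

Lemma touchC G A B : touch G A B -> touch G B A.
Proof. by case=> x [y [xA yB h]]; exists y, x; split=> //; rewrite eq_sym adjC. Qed.

Lemma touchS G A A' B B' : A \subset A' -> B \subset B' -> touch G A B -> touch G A' B'.
Proof.
by move=> /subsetP sA /subsetP sB [x [y [/sA xA /sB yB h]]]; exists x, y.
Qed.

Lemma touch_adj G A B x y : x \in A -> y \in B -> adj G x y -> touch G A B.
Proof. by move=> xA yB h; exists x, y; rewrite xA yB h orbT. Qed.

Lemma touch_eq G A B x : x \in A -> x \in B -> touch G A B.
Proof. by move=> xA xB; exists x, x; rewrite xA xB eqxx. Qed.

Lemma touch_setU1l G A B y : touch G (y |: A) B -> ~ touch G [set y] B -> touch G A B.
Proof.
case=> x [w [+ wB h]] n; rewrite !inE => /predU1P[e|xA]; last by exists x, w.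
by case: n; exists y, w; rewrite inE eqxx -e.
Qed.

Lemma conn_set1 G x : conn_set G [set x].
Proof. by move=> a b /set1P-> /set1P->; apply: connect0. Qed.

Lemma inner_sym G S : symmetric (inner G S).
Proof. by move=> x y; rewrite /inner /= adjC; do !bool_congr. Qed.

Lemma innerS G S S' : S \subset S' ->
  subrel (connect (inner G S)) (connect (inner G S')).
Proof.
move=> /subsetP s; apply: connect_sub => x y /and3P[xS yS h].
by apply: connect1; rewrite /inner /= !s.
Qed.

Lemma conn_setU G A B : conn_set G A -> conn_set G B -> touch G A B ->
  conn_set G (A :|: B).
Proof.
move=> cA cB [p [q [pA qB pq]]].
have cp x : x \in A :|: B -> connect (inner G (A :|: B)) p x.
  rewrite inE => /orP[xA|xB]; first by apply: innerS (cA _ _ pA xA); apply: subsetUl.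
  have qx : connect (inner G (A :|: B)) q x.
    by apply: innerS (cB _ _ qB xB); apply: subsetUr.
  case/orP: pq => [/eqP->//|pq]; apply: connect_trans qx; apply: connect1.
  by rewrite /inner /= !inE pA qB orbT.
move=> x y xS yS; apply: (@connect_trans _ _ p); last exact: cp.
by rewrite (sym_connect_sym (inner_sym G _)) cp.
Qed.

Lemma hole_seq_adj G s x y : hole_seq G s -> x \in s -> y \in s ->
  index x s < index y s ->
  adj G x y = (index y s == (index x s).+1) ||
              (index x s == 0) && (index y s == (size s).-1).
Proof.
case=> us _ _ adjs xs ys l; rewrite -{1}(nth_index x xs) -{1}(nth_index x ys) adjs //.
by rewrite l index_mem.
Qed.

Lemma conn_set_interval G s p q : hole_seq G s ->
  conn_set G [set x in s | p <= index x s < q].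
Proof.
case=> us _ _ adjs; set S := [set x in s | _].
have memS x0 k : k < size s -> p <= k < q -> nth x0 s k \in S.
  by move=> ks kpq; rewrite inE mem_nth //= index_uniq.
have con x0 k : p + k < size s -> p + k < q ->
    connect (inner G S) (nth x0 s p) (nth x0 s (p + k)).
  elim: k => [|k IH] hs hq; first by rewrite addn0.
  apply: connect_trans (IH _ _) _; [arith|arith|apply: connect1].
  rewrite /inner /= !memS; try arith.
  by rewrite adjs ?addnS ?eqxx //; arith.
have cx x0 x : x \in S -> connect (inner G S) (nth x0 s p) x.
  rewrite inE => /andP[xs hx]; rewrite -[X in connect _ _ X](nth_index x0 xs).
  have l : index x s < size s by rewrite index_mem.
  have -> : index x s = p + (index x s - p) by arith.
  by apply: con; arith.
move=> x y xS yS; apply: connect_trans (cx x y yS).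
by rewrite (sym_connect_sym (inner_sym G _)) cx.
Qed.

(** The interior of a path from [u] to [y], kept only as a connected set with a single neighbour [a]
    of [u] and a single neighbour [c] of [y]; [a = c] is possible. *)
Definition arc G u y A a c : Prop :=
  [/\ [/\ u \notin A, y \notin A & conn_set G A],
      [/\ a \in A, adj G u a & forall x, x \in A -> adj G u x -> x = a] &
      [/\ c \in A, adj G y c & forall x, x \in A -> adj G y x -> x = c]].

Definition arcs G X u y A B : Prop :=
  [/\ exists a c, arc G u y A a c, exists b d, arc G u y B b d, ~ touch G A B &
      X = [set u; y] :|: (A :|: B)].

Lemma arcsC G X u y A B : arcs G X u y A B -> arcs G X u y B A.
Proof. by case=> hA hB nt ->; split=> //; [move/touchC | rewrite (setUC A)]. Qed.

Lemma hole_arcs G X u y : is_hole G X -> u \in X -> y \in X -> u != y ->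
  ~~ adj G u y ->
  exists A B, arcs G X u y A B.
Proof.
move=> hX uX yX uy nuy.
have [s [hs us iu eX]] := hole_seq_of hX uX.
have ys : y \in s by move: yX; rewrite eX inE.
have [uq ss sV adjs] := hs.
have iy : index y s < size s by rewrite index_mem.
have iy0 : 0 < index y s.
  by rewrite lt0n; apply: contra uy => /eqP e; rewrite -(nth_index u us) -(nth_index u ys) iu e.
have := hole_seq_adj hs us ys; rewrite iu (negPf nuy) eqxx => /(_ iy0)/esym nadj.
have [i iE] : exists i, index y s = i by eexists.
rewrite iE in iy iy0 nadj.
(* As [y] is not adjacent to [u], its position is neither 1 nor the last one; both arcs are
   therefore nonempty. *)
have {iy iy0 nadj} [ilb iub] : 1 < i /\ i.+1 < size s by split; arith.
have eqi x k : x \in s -> index x s = k -> x = nth u s k.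
  by move=> xs <-; rewrite nth_index.
have inj x x' : x \in s -> x' \in s -> index x s = index x' s -> x = x'.
  by move=> xs xs' e; rewrite (eqi _ _ xs e) nth_index.
pose A := [set x in s | 1 <= index x s < i].
pose B := [set x in s | i.+1 <= index x s < size s].
have mem k : k < size s -> (nth u s k \in s) * (index (nth u s k) s = k).
  by move=> ks; rewrite mem_nth // index_uniq.
have [m1 i1] := mem 1 ltac:(arith).
have [m2 i2] := mem (size s).-1 ltac:(arith).
have [m3 i3] := mem i.-1 ltac:(arith).
have [m4 i4] := mem i.+1 ltac:(arith).
exists A, B; split.
- exists (nth u s 1), (nth u s i.-1); split; split.
  + by rewrite inE us iu.
  + by rewrite inE ys iE; arith.
  + exact: conn_set_interval.
  + by rewrite inE m1 i1; arith.
  + by rewrite (hole_seq_adj hs) // iu i1.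
  + move=> x; rewrite inE => /andP[xs hx]; rewrite (hole_seq_adj hs) // iu; last arith.
    by move=> h; apply: eqi => //; arith.
  + by rewrite inE m3 i3; arith.
  + by rewrite adjC (hole_seq_adj hs) // i3 iE; arith.
  + move=> x; rewrite inE => /andP[xs hx]; rewrite adjC (hole_seq_adj hs) // iE; last arith.
    by move=> h; apply: eqi => //; arith.
- exists (nth u s (size s).-1), (nth u s i.+1); split; split.
  + by rewrite inE us iu.
  + by rewrite inE ys iE; arith.
  + exact: conn_set_interval.
  + by rewrite inE m2 i2; arith.
  + by rewrite (hole_seq_adj hs) // iu i2; arith.
  + move=> x; rewrite inE => /andP[xs hx]; rewrite (hole_seq_adj hs) // iu; last arith.
    by move=> h; apply: eqi => //; arith.
  + by rewrite inE m4 i4; arith.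
  + by rewrite (hole_seq_adj hs) // i4 iE; arith.
  + move=> x; rewrite inE => /andP[xs hx]; rewrite (hole_seq_adj hs) // iE; last arith.
    by move=> h; apply: eqi => //; arith.
- case=> x [x' []]; rewrite !inE => /andP[xs hx] /andP[xs' hx'] /orP[/eqP e|].
    by rewrite e in hx; arith.
  by rewrite (hole_seq_adj hs) //; arith.
apply/setP=> x; rewrite eX !inE; case xs: (x \in s) => /=; last first.
  by apply/esym/negbTE; rewrite orbF; apply/norP; split; apply: contraFN xs => /eqP->.
have ix : index x s < size s by rewrite index_mem.
case: (x =P u) => //= nu; case: (x =P y) => //= ny.
have n0 : index x s <> 0 by move=> e; apply: nu; apply: inj => //; rewrite iu.
have ni : index x s <> i by move=> e; apply: ny; apply: inj; rewrite ?iE.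
by arith.
Qed.

Lemma hole_neighbours G X u : is_hole G X -> u \in X ->
  exists y z Q, [/\ [/\ y \in X, z \in X & Q \subset X],
    [/\ adj G u y, adj G u z, y != z & ~~ adj G y z],
    [/\ conn_set G Q, Q != set0, u \notin Q & forall q, q \in Q -> ~~ adj G u q] &
    [/\ touch G [set y] Q, touch G [set z] Q & X = [set u; y; z] :|: Q]].
Proof.
move=> hX uX.
have [s [hs us iu eX]] := hole_seq_of hX uX.
have [uq ss sV adjs] := hs.
(* The neighbours of [u] sit at position 1 and at the last position; [Q] is the rest, nonempty since
   a hole has at least 4 vertices. *)
pose Q := [set x in s | 2 <= index x s < (size s).-1].
have mem k : k < size s -> (nth u s k \in s) * (index (nth u s k) s = k).
  by move=> ks; rewrite mem_nth // index_uniq.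
have [m1 i1] := mem 1 ltac:(arith).
have [m2 i2] := mem (size s).-1 ltac:(arith).
have [m3 i3] := mem 2 ltac:(arith).
have [m4 i4] := mem (size s).-2 ltac:(arith).
exists (nth u s 1), (nth u s (size s).-1), Q; split.
- by split; rewrite eX ?inE //; apply/subsetP=> x; rewrite !inE => /andP[].
- split; rewrite ?(hole_seq_adj hs) ?iu ?i1 ?i2 ?eqxx ?orbT //; try arith.
  by apply/eqP=> e; move: i2; rewrite -e i1; arith.
- split; first exact: conn_set_interval.
  + by apply/set0Pn; exists (nth u s 2); rewrite inE m3 i3; arith.
  + by rewrite inE iu; arith.
  + by move=> q; rewrite inE => /andP[qs hq]; rewrite (hole_seq_adj hs) ?iu //; arith.
split.
- apply: (@touch_adj _ _ _ (nth u s 1) (nth u s 2)); rewrite ?inE ?eqxx ?m3 ?i3 //; try arith.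
  by rewrite (hole_seq_adj hs) ?i1 ?i3.
- apply: (@touch_adj _ _ _ (nth u s (size s).-1) (nth u s (size s).-2)).
  + by rewrite inE.
  + by rewrite inE m4 i4; arith.
  + by rewrite adjC (hole_seq_adj hs) ?i2 ?i4 //; arith.
apply/setP=> x; rewrite eX !inE; case xs: (x \in s) => /=; last first.
  apply/esym/negbTE; rewrite orbF -orbA; apply/or3P.
  by case=> /eqP e; move: xs; rewrite e ?us ?m1 ?m2.
have ix : index x s < size s by rewrite index_mem.
have ne k : k < size s -> x <> nth u s k -> index x s <> k.
  by move=> ks nx e; apply: nx; rewrite -e nth_index.
case: (x =P u) => //= nu; case: (x =P _) => //= /ne n1; case: (x =P _) => //= /ne n2.
have n0 : index x s <> 0 by apply: ne; [arith | rewrite -iu nth_index].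
have {}n1 := n1 ltac:(arith); have {}n2 := n2 ltac:(arith).
by arith.
Qed.

(* An induced path of [S] from [a] to [b], closed up through [y], is a hole:
   it is taken as a shortest path. *)
Lemma hole_of_conn G S y a b : y \notin S -> a \in S -> b \in S -> conn_set G S ->
  adj G y a -> adj G y b -> a != b -> ~~ adj G a b ->
  (forall x, x \in S -> adj G y x -> x = a \/ x = b) ->
  exists X, [/\ is_hole G X, [/\ y \in X, a \in X & b \in X], X \subset y |: S &
    conn_set G (X :\ y)].
Proof.
move=> yS aS bS cS ya yb ab nab uniqN.
pose e := inner G S.
pose P k := [exists p : k.-tuple T, path e a p && (last a p == b)].
have exP : exists k, P k.
  have /connectP[p pp lp] := cS _ _ aS bS.
  by exists (size p); apply/existsP; exists (in_tuple p); rewrite /= pp -lp eqxx.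
case: (ex_minnP exP) => n /existsP[p0 /andP[pp /eqP lp]] minP.
have {minP} minP q : path e a q -> last a q = b -> n <= size q.
  move=> pq lq; apply: minP; apply/existsP; exists (in_tuple q).
  by rewrite /= pq lq eqxx.
have szp : size p0 = n by rewrite size_tuple.
move: (tval p0) pp lp szp => p {p0} pp lp szp.
pose s := a :: p.
have sS x : x \in s -> x \in S.
  rewrite inE => /predU1P[->//|].
  elim: p a pp {lp szp minP s aS ya ab nab uniqN exP P} => //= c p IH a0.
  move=> /andP[/and3P[_ cS' _] pp].
  by rewrite inE => /predU1P[->//|]; apply: IH pp.
(* Removing repetitions cannot shorten a path of minimal length, so there are none. *)
have us : uniq s.
  have [p' [pp' lp'] [up' sp']] : exists2 p', path e a p' /\ last a p' = b &
      uniq (a :: p') /\ {subset p' <= p}.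
    by case/shortenP: pp lp => p' pp' up' sp' lp'; exists p'.
  apply: leq_size_uniq up' _ _; last by rewrite /= szp ltnS minP.
  by move=> x; rewrite !inE => /predU1P[->|/sp'->]; rewrite ?eqxx ?orbT.
have cons_adj k : k < n -> adj G (nth y s k) (nth y s k.+1).
  by move=> kn; have /(pathP y)/(_ k) := pp; rewrite szp => /(_ kn) /and3P[].
have chord i j : i.+1 < j <= n -> ~~ adj G (nth y s i) (nth y s j).
  move=> ij; apply/negP=> h.
  have dj : drop j.-1 p = nth y s j :: drop j p.
    by case: j ij {h} => // j ij; rewrite (drop_nth y) //= szp; arith.
  have li : last a (take i p) = nth y s i.
    case: i ij {h} => [|i] ij; first by rewrite take0.
    by rewrite (take_nth y) ?last_rcons // szp; arith.
  (* Entry [j] of [s = a :: p] is entry [j.-1] of [p]. A chord from [i] to [j] gives a path of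
     length [i + (n - j.-1)], which is less than [n] because [i.+1 < j]. *)
  have := minP (take i p ++ drop j.-1 p).
  rewrite cat_path last_cat size_cat size_take size_drop szp take_path //= li dj /=.
  have -> : e (nth y s i) (nth y s j).
    by rewrite /e /inner /= h !sS // mem_nth //= szp; arith.
  have pd : path e (nth y s j) (drop j p) /\ last (nth y s j) (drop j p) = b.
    move: pp lp; rewrite -{1 2}(cat_take_drop j.-1 p) cat_path last_cat dj /=.
    by case/and3P.
  case: pd => -> -> /(_ isT erefl); case: ifP; arith.
have s0 : nth y s 0 = a by [].
have sn : nth y s n = b by rewrite -lp (last_nth y) szp.
have n2 : 1 < n.
  case: n szp minP cons_adj chord sn => [|[|n]] // szp _ adjs _ sn.
    by rewrite -sn s0 eqxx in ab.
  by have := adjs 0 isT; rewrite s0 sn (negPf nab).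
have szs : size s = n.+1 by rewrite /= szp.
have szys : size (y :: s) = n.+2 by rewrite /= szp.
have hs : hole_seq G (y :: s).
  split.
  - by rewrite cons_uniq us andbT; apply: contra yS; apply: sS.
  - by rewrite /= szp; arith.
  - move=> x; rewrite inE => /predU1P[->|xs]; first by rewrite (adj_gV ya).
    have : x \in s by [].
    case/(nthP y) => k; rewrite szs => kn <-; case: (ltnP k n) => [/cons_adj/adj_gV[]//|hk].
    by have -> : k = n by [arith]; rewrite sn (adj_gV yb).
  move=> x0 i j; rewrite szys => ij.
  have /(set_nth_default y)-> : i < size (y :: s) by rewrite szys; arith.
  have /(set_nth_default y)-> : j < size (y :: s) by rewrite szys; arith.
  case: j ij => [|j] ij; first arith.
  case: i ij => [|i] ij; rewrite /=.
    apply/idP/idP => [h|].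
      have /uniqN : nth y s j \in S by apply: sS; apply: mem_nth; rewrite szs; arith.
      case/(_ h) => [|] ej; apply/orP; [left|right].
        by have := nth_uniq y _ _ us; move=> /(_ j 0); rewrite ej s0 eqxx szs; arith.
      by have := nth_uniq y _ _ us; move=> /(_ j n); rewrite ej sn eqxx szs; arith.
    case/orP => ej; first by have -> : j = 0 by [arith]; rewrite s0.
    by have -> : j = n by [arith]; rewrite sn.
  case: (eqVneq j i.+1) => [->|nj]; first by rewrite cons_adj ?eqxx //; arith.
  by move/eqP: nj => nj; rewrite (negPf (chord _ _ _)); arith.
exists [set x in y :: s]; split.
- exact: hole_of_seq.
- have bs : b \in s by rewrite -lp mem_last.
  by split; rewrite in_set in_cons ?eqxx ?bs ?mem_head ?orbT.
- by apply/subsetP=> x; rewrite !inE => /predU1P[->|/sS->]; rewrite ?eqxx ?orbT.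
have -> : [set x in y :: s] :\ y = [set x in y :: s | 1 <= index x (y :: s) < (size s).+1].
  apply/setP=> x; rewrite in_setD1 !in_set in_cons.
  have -> : index x (y :: s) = if y == x then 0 else (index x s).+1 by [].
  case: (eqVneq y x) => [<-|ne]; rewrite ?eqxx // -index_mem.
  exact: esym (andbb _).
exact: conn_set_interval.
Qed.

Lemma hole_gV G X : is_hole G X -> X \subset gV G.
Proof. by case=> s [_ _ -> sV _]; apply/subsetP=> x; rewrite inE => /sV. Qed.

(** * Local chordalization *)

(** The set [A :|: W :|: B] is connected, avoids [u], and meets the neighbourhood of [y] only in the
    ends of the two arcs. Closing it up through [y] gives a hole that misses [u] and shares with [H]
    the two edges at [y], against NC. *)
Lemma NC_arcs G u y H A B W :
  NC_vertex G u -> is_hole G H -> u != y -> arcs G H u y A B ->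
  conn_set G W -> u \notin W -> ~ touch G [set y] W ->
  touch G A W -> touch G B W -> False.
Proof.
move=> nc hH uy [[a [c [[uA yA cA] _ [cc yc uc]]]] [b [d [[uB yB cB] _ [dd yd ud]]]] nAB eH].
move=> cW uW yW tA tB.
have cS : conn_set G (A :|: W :|: B).
  apply: conn_setU => //; first exact: conn_setU.
  by apply: touchC; apply: touchS tB => //; apply: subsetUr.
have yW' w : w \in W -> (w != y) && ~~ adj G y w.
  move=> wW; apply/andP; split.
    by apply/eqP=> e; apply: yW; apply: (@touch_eq _ _ _ y); rewrite ?inE // -e.
  by apply/negP=> h; apply: yW; apply: touch_adj h; rewrite ?inE.
have cd : c != d.
  by apply/eqP=> e; apply: nAB; apply: (@touch_eq _ _ _ c); rewrite // e.
have ncd : ~~ adj G c d by apply/negP=> h; apply: nAB; apply: touch_adj h.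
have [||||X [hX [yX cX dX] sX _]] :=
  @hole_of_conn G (A :|: W :|: B) y c d _ _ _ cS yc yd cd ncd.
- rewrite !inE (negPf yA) (negPf yB) orbF; apply/negP=> /yW'.
  by rewrite eqxx.
- by rewrite !inE cc.
- by rewrite !inE dd orbT.
- move=> x; rewrite !inE -orbA.
  by case/or3P=> [xA /(uc _ xA)|/yW'/andP[_ /negPf->]//|xB /(ud _ xB)]; [left|right].
apply: nc; exists H, X, c, y, d; split; split=> //.
- by rewrite eH !inE eqxx.
- apply/negP=> /(subsetP sX).
  by rewrite !inE (negPf uy) (negPf uA) (negPf uB) (negPf uW).
- by rewrite adjC.
- by rewrite eH !inE cc dd eqxx !orbT.
Qed.

(** If [Y] and [Z] did not touch, closing up [Y], [D], [Z] through [u] would give a hole. Holes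
    through [u] avoid [D], so the rest of it would connect [Y] to [Z] directly. *)
Lemma arcs_touch G u D Y Z a c :
  u \notin Y -> u \notin D -> u \notin Z -> conn_set G Y -> conn_set G D -> conn_set G Z ->
  touch G Y D -> touch G Z D -> (forall x, x \in D -> ~~ adj G u x) ->
  (forall X x, is_hole G X -> u \in X -> x \in X -> x \notin D) ->
  a \in Y -> adj G u a -> (forall x, x \in Y -> adj G u x -> x = a) ->
  c \in Z -> adj G u c -> (forall x, x \in Z -> adj G u x -> x = c) ->
  touch G Y Z.
Proof.
move=> uY uD uZ cY cD cZ tY tZ nD hD aY ua uniqa cZ' uc uniqc.
case: (asboolP (touch G Y Z)) => // nt; exfalso.
have cS : conn_set G (Y :|: D :|: Z).
  apply: conn_setU => //; first exact: conn_setU.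
  by apply: touchC; apply: touchS tZ => //; apply: subsetUr.
have ac : a != c by apply/eqP=> e; apply: nt; apply: (@touch_eq _ _ _ a); rewrite // e.
have nac : ~~ adj G a c by apply/negP=> h; apply: nt; apply: touch_adj h.
have [||||X [hX [uX aX cX] sX cXu]] :=
  @hole_of_conn G (Y :|: D :|: Z) u a c _ _ _ cS ua uc ac nac.
- by rewrite !inE (negPf uY) (negPf uD) (negPf uZ).
- by rewrite !inE aY.
- by rewrite !inE cZ' orbT.
- move=> x; rewrite !inE -orbA.
  by case/or3P=> [xY /(uniqa _ xY)|/nD/negPf->//|xZ /(uniqc _ xZ)]; [left|right].
have sYZ : X :\ u \subset Y :|: Z.
  apply/subsetP=> x; rewrite !inE => /andP[xu xX].
  have := subsetP sX _ xX; rewrite !inE (negPf xu) (negPf (hD _ _ hX uX xX)) /=.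
  by rewrite orbF.
have /connectP[p pp lp] : connect (inner G (X :\ u)) a c.
  apply: cXu; rewrite !inE ?aX ?cX andbT.
    by apply: contraTneq aY => ->.
  by apply: contraTneq cZ' => ->.
(* Starting in [Y], the path never leaves it, since a step into [Z] would make the sets touch. *)
suff : last a p \in Y.
  by rewrite -lp => cY'; apply: nt; apply: (@touch_eq _ _ _ c).
elim: p a aY pp {lp ua uniqa ac nac aX} => //= x p IH a aY /andP[/and3P[_ xX ax]].
apply: IH; have := subsetP sYZ _ xX; rewrite inE => /orP[//|xZ].
by case: nt; apply: touch_adj ax.
Qed.

Lemma on_hole_withP G u w :
  reflect (w != u /\ exists H, [/\ is_hole G H, u \in H & w \in H]) (on_hole_with G u w).
Proof. by apply: (iffP andP) => -[wu /asboolP h]. Qed.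

Lemma adj_lc G u x y : adj (local_chordalize G u) x y =
  [|| adj G x y, (x == u) && on_hole_with G u y | (y == u) && on_hole_with G u x].
Proof.
have hV w : on_hole_with G u w -> [&& u \in gV G, w \in gV G & u != w].
  case/on_hole_withP=> wu [H [/hole_gV/subsetP sH uH wH]].
  by rewrite !sH // eq_sym.
rewrite adjE; apply/idP/idP.
  case/and4P=> _ _ _ /orP[/orP[->//|->]|/orP[|->]]; rewrite ?orbT //.
  by rewrite adjC => ->.
case/or3P=> [h|/andP[/eqP-> h]|/andP[/eqP-> h]].
- by rewrite h (adj_neq h) !(adj_gV h).
- by case/and3P: (hV _ h) => -> -> ->; rewrite eqxx h orbT.
- by case/and3P: (hV _ h) => -> ->; rewrite eq_sym => ->; rewrite eqxx h !orbT.
Qed.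

(* If [y] is not a neighbour of [u], the two arcs between [u] and [y] of a hole
   through both must touch every connection from [z] to [u], since otherwise
   [Q] would lie on a hole through [u]; closing up those arcs away from [u] gives
   a hole avoiding [u] with two consecutive edges at [y] or at [z]. *)
Lemma NC_no_bridge G u y z Q :
  NC_vertex G u -> u != y -> u != z -> u \notin Q ->
  ~~ adj G u y -> on_hole_with G u y -> adj G u z || on_hole_with G u z ->
  y != z -> ~~ adj G y z -> conn_set G Q -> touch G [set y] Q -> touch G [set z] Q ->
  (forall q, q \in Q -> ~~ adj G u q) -> (forall q, q \in Q -> ~~ on_hole_with G u q) ->
  False.
Proof.
move=> nc uy uz uQ nuy /on_hole_withP[_ [H [hH uH yH]]] hz yz nyz cQ tyQ tzQ nQ hQ.
have holeQ X x : is_hole G X -> u \in X -> x \in X -> x \notin Q.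
  move=> hX uX xX; apply/negP=> xQ; case/negP: (hQ _ xQ); apply/on_hole_withP.
  split; last by exists X.
  by apply: contraTneq xQ => ->.
have [A [B hAB]] := hole_arcs hH uH yH uy nuy.
have nyz' : ~ touch G [set z] [set y].
  by case=> x [x' [/set1P-> /set1P-> ]]; rewrite eq_sym (negPf yz) adjC (negPf nyz).
(* As [z] does not touch [y], this makes [z] touch both arcs themselves, and [NC_arcs] applies with
   [[set z]] as the connecting set. *)
suff main A' B' : arcs G H u y A' B' -> touch G (y |: A') [set z].
  have tA := touch_setU1l (main _ _ hAB) (fun h => nyz' (touchC h)).
  have tB := touch_setU1l (main _ _ (arcsC hAB)) (fun h => nyz' (touchC h)).
  apply: (NC_arcs nc hH uy hAB (@conn_set1 _ z)) tA tB; first by rewrite inE.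
  by move/touchC.
move=> {A B hAB} hAB; case: (hAB) => -[a [c [[uA yA cA] [aA ua uniqa] [cc yc uc]]]] _ _ _.
case: (asboolP (touch G (y |: A') [set z])) => // nt; exfalso.
set Y := y |: A'.
have uY : u \notin Y by rewrite !inE (negPf uy).
have cY : conn_set G Y.
  by apply: conn_setU => //; [exact: conn_set1 | apply: touch_adj yc; rewrite ?inE].
have tY : touch G Y Q by apply: touchS tyQ => //; apply: subsetUl.
have aY : a \in Y by rewrite !inE aA orbT.
have uniqY x : x \in Y -> adj G u x -> x = a.
  by rewrite !inE => /predU1P[->|/uniqa//]; rewrite (negPf nuy).
(* If [uz] is an edge of [G], the singleton of [z] plays the role of the second arc; otherwise [z]
   lies on a hole [H2] with [u], and the argument is repeated at [z] with [Y] as the connecting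
   set. *)
have [uz'|nuz] := boolP (adj G u z).
  apply: nt; apply: (@arcs_touch G u Q Y [set z] a z) => //; rewrite ?inE //.
  - exact: conn_set1.
  - by move=> x /set1P.
move: hz; rewrite (negPf nuz) /= => /on_hole_withP[_ [H2 [hH2 uH2 zH2]]].
have [A2 [B2 hAB2]] := hole_arcs hH2 uH2 zH2 uz nuz.
suff main A3 B3 : arcs G H2 u z A3 B3 -> touch G A3 Y.
  have nt' : ~ touch G [set z] Y by move/touchC.
  by apply: (NC_arcs nc hH2 uz hAB2 cY uY nt'); [apply: main hAB2 | apply: main (arcsC hAB2)].
case=> -[a3 [c3 [[uA3 zA3 cA3] [aA3 ua3 uniqa3] [cc3 zc3 uc3]]]] _ _ _.
have : touch G Y (z |: A3).
  apply: (@arcs_touch G u Q Y (z |: A3) a a3) => //.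
  - by rewrite !inE (negPf uz).
  - apply: conn_setU => //; [exact: conn_set1 | apply: touch_adj zc3; rewrite ?inE //].
  - by apply: touchS tzQ => //; apply: subsetUl.
  - by rewrite !inE aA3 orbT.
  - by move=> x; rewrite !inE => /predU1P[->|/uniqa3//]; rewrite (negPf nuz).
by move/touchC/touch_setU1l; apply=> /touchC.
Qed.

(** All new edges end in [u], so the holes avoiding [u] are the same in both graphs. Suppose that a
    hole of the new graph passes through [u]. If one of its edges at [u] is new, [NC_no_bridge]
    applies. If both are old, it is already a hole of [G], and then all its vertices have been
    joined to [u]. *)
Lemma lc_holeP G u X : NC_vertex G u ->
  is_hole (local_chordalize G u) X <-> is_hole G X /\ u \notin X.
Proof.
move=> nc; set G' := local_chordalize G u.
have eqadj x y : x != u -> y != u -> adj G x y = adj G' x y.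
  by move=> xu yu; rewrite adj_lc (negPf xu) (negPf yu) !orbF.
have eqadjX : u \notin X -> {in X &, forall x y, adj G x y = adj G' x y}.
  by move=> uX x y xX yX; apply: eqadj; [apply: contraNneq uX => <-..].
split=> [hX|[hX uX]]; last first.
  by apply: (eq_graph_hole _ (eqadjX uX)) (hX); apply: (hole_gV hX).
suff uX : u \notin X.
  split=> //; apply: eq_graph_hole (hX); first exact: (hole_gV hX).
  by move=> x y xX yX; rewrite eqadjX.
apply/negP=> uX.
have [y [z [Q [[yX zX sQ] [uy uz yz nyz] [cQ Q0 uQ nQ] [tyQ tzQ eX]]]]] := hole_neighbours hX uX.
have yu : y != u by rewrite eq_sym (adj_neq uy).
have zu : z != u by rewrite eq_sym (adj_neq uz).
have Qu q : q \in Q -> q != u by move=> qQ; apply: contraTneq qQ => ->.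
have nQ1 q : q \in Q -> ~~ adj G u q.
  by move=> /nQ; apply: contra => h; rewrite adj_lc h.
have nQ2 q : q \in Q -> ~~ on_hole_with G u q.
  by move=> /nQ; apply: contra => h; rewrite adj_lc h eqxx orbT.
have cQ' : conn_set G Q.
  move=> x x' xQ xQ'; have := cQ _ _ xQ xQ'; apply: connect_sub => p q /and3P[pQ qQ h].
  by apply: connect1; rewrite /inner /= pQ qQ eqadj ?Qu.
have tch w : w != u -> touch G' [set w] Q -> touch G [set w] Q.
  move=> wu [p [q [/set1P-> qQ h]]]; exists w, q; split; rewrite ?inE //.
  by rewrite (eqadj _ _ wu (Qu _ qQ)).
have hy : adj G u y || on_hole_with G u y.
  by move: uy; rewrite adj_lc eqxx (negPf yu) orbF.
have hz : adj G u z || on_hole_with G u z.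
  by move: uz; rewrite adj_lc eqxx (negPf zu) orbF.
have nyz' : ~~ adj G y z by rewrite eqadj.
have [uy'|nuy] := boolP (adj G u y); last first.
  rewrite (negPf nuy) /= in hy.
  apply: (@NC_no_bridge G u y z Q) (tch _ yu tyQ) (tch _ zu tzQ) nQ1 nQ2 => //.
  - by rewrite eq_sym.
  - by rewrite eq_sym.
have [uz'|nuz] := boolP (adj G u z); last first.
  rewrite (negPf nuz) /= in hz.
  apply: (@NC_no_bridge G u z y Q) (tch _ zu tzQ) (tch _ yu tyQ) nQ1 nQ2 => //.
  - by rewrite eq_sym.
  - by rewrite eq_sym.
  - by rewrite eq_sym.
  - by rewrite adjC.
have /set0Pn[q qQ] := Q0.
have : is_hole G X.
  apply: eq_graph_hole (hX); first exact: (hole_gV hX).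
  have adju x : x \in X -> adj G u x = adj G' u x.
    rewrite eX !inE -!orbA => /or4P[/eqP->|/eqP->|/eqP->|xQ].
    - by rewrite !adjxx.
    - by rewrite uy uy'.
    - by rewrite uz uz'.
    - by rewrite (negPf (nQ _ xQ)) (negPf (nQ1 _ xQ)).
  move=> x x' xX xX'; apply/esym; case: (eqVneq x u) => [->|xu]; first exact: adju.
  case: (eqVneq x' u) => [->|xu']; first by rewrite adjC adju // adjC.
  exact: eqadj.
move=> hXG; case/negP: (nQ2 _ qQ); apply/on_hole_withP; split; first exact: Qu.
by exists X; split=> //; rewrite (subsetP sQ).
Qed.

Lemma NC_set_uniq G C X u v : NC_set G C -> is_hole G X ->
  u \in X -> v \in X -> u \in C -> v \in C -> u = v.
Proof.
case=> _ h1 /h1/card_le1_eqP h uX vX uC vC.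
by apply: h; rewrite inE ?uX ?vX.
Qed.

(** A hole of [G] through [v] cannot contain [u] as well, hence survives the chordalization by [u],
    and no hole is created. The edges to be added at [v] can thus be read off in the graph before
    the step. *)
Lemma on_hole_lc G C u v w : NC_set G C -> u \in C -> v \in C -> u != v ->
  on_hole_with (local_chordalize G u) v w = on_hole_with G v w.
Proof.
move=> nc uC vC uv; have ncu := nc.1 _ uC.
apply/on_hole_withP/on_hole_withP => -[wv [H [hH vH wH]]]; split=> //; exists H; split=> //.
  by case/(lc_holeP _ ncu): hH.
apply/(lc_holeP _ ncu); split=> //; apply: contra uv => uH.
by rewrite (NC_set_uniq nc hH uH vH uC vC).
Qed.

(** The holes of the new graph are old holes avoiding [u], and the edges on them are old, so a
    violation of NC was present before. *)
Lemma NC_set_lc G C u : NC_set G C -> u \in C -> NC_set (local_chordalize G u) C.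
Proof.
move=> nc uC; have ncu := nc.1 _ uC; split=> [v vC|H]; last first.
  by case/(lc_holeP _ ncu) => /(nc.2 H).
case=> H [H' [a [b [c [[hH vH hH' vH'] [ac ab bc iH iH']]]]]].
have [hG uH] := iffLR (lc_holeP _ ncu) hH.
have [hG' _] := iffLR (lc_holeP _ ncu) hH'.
apply: (nc.1 _ vC); exists H, H', a, b, c; split=> //; case: iH => aH bH cH.
have nu x : x \in H -> (x == u) = false.
  by move=> xH; apply: contraNF uH => /eqP <-.
by move: ab bc; rewrite !adj_lc !nu // !orbF.
Qed.

Lemma adj_foldl_lc G C s : NC_set G C -> uniq s -> {subset s <= C} ->
  forall x y, adj (foldl (@local_chordalize T) G s) x y =
    [|| adj G x y, (x \in s) && on_hole_with G x y | (y \in s) && on_hole_with G y x].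
Proof.
elim: s G => [|u s IH] G nc us sC x y; first by rewrite /= !orbF.
have /= /andP[us' {}us] := us.
have uC : u \in C by apply: sC; rewrite mem_head.
have sC' : {subset s <= C} by move=> v vs; apply: sC; rewrite inE vs orbT.
rewrite (IH _ (NC_set_lc nc uC) us sC') adj_lc !inE.
have E v w : v \in s -> on_hole_with (local_chordalize G u) v w = on_hole_with G v w.
  by move=> vs; apply: on_hole_lc nc uC (sC' _ vs) _; apply: contraNneq us' => ->.
have E' v w : (v \in s) && on_hole_with (local_chordalize G u) v w =
    (v \in s) && on_hole_with G v w.
  by case vs: (v \in s) => //=; apply: E.
rewrite !E' !andb_orl.
case: (eqVneq x u) => [->|_]; case: (eqVneq y u) => [->|_] //=; rewrite ?orbF -?orbA;
  by do ![case: (adj _ _ _) => //= | case: (on_hole_with _ _ _) => //=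
         | case: (_ \in s) => //=].
Qed.

Lemma gV_hatG G C : gV (hatG G C) = gV G.
Proof. by rewrite /hatG; elim: (enum C) G => //= u s IH G; rewrite IH. Qed.

Lemma adj_hatG G C x y : NC_set G C -> adj (hatG G C) x y =
  [|| adj G x y, (x \in C) && on_hole_with G x y | (y \in C) && on_hole_with G y x].
Proof.
move=> nc; rewrite /hatG (adj_foldl_lc nc) ?enum_uniq ?mem_enum //.
by move=> u; rewrite mem_enum.
Qed.

(** * Cliques under one chordalization step *)

Lemma cliqueP G K :
  reflect (K \subset gV G /\ {in K &, forall x y, x != y -> adj G x y}) (clique G K).
Proof.
apply: (iffP andP) => -[sK h]; split=> //.
  by move=> x y xK yK; have /forall_inP/(_ x xK)/forall_inP/(_ y yK)/implyP := h.
by apply/forall_inP=> x xK; apply/forall_inP=> y yK; apply/implyP; apply: h.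
Qed.

Lemma hole_C4 G a b c d : adj G a b -> adj G b c -> adj G c d -> adj G d a ->
  a != c -> b != d -> ~~ adj G a c -> ~~ adj G b d ->
  exists X, [/\ is_hole G X, a \in X & b \in X].
Proof.
move=> ab bc cd da ac bd nac nbd.
have [||||||X [hX [aX bX _] _ _]] :=
  @hole_of_conn G ([set b; c] :|: [set d]) a b d _ _ _ _ ab _ bd nbd.
- by rewrite !inE (negPf ac) (negPf (adj_neq ab)) eq_sym (negPf (adj_neq da)).
- by rewrite !inE eqxx.
- by rewrite !inE eqxx orbT.
- apply: conn_setU; [apply: conn_setU | apply: conn_set1 |]; try exact: conn_set1.
    by apply: touch_adj bc; rewrite inE.
  by apply: touch_adj cd; rewrite !inE eqxx ?orbT.
- by rewrite adjC.
- by move=> x; rewrite !inE -orbA => /or3P[/eqP->|/eqP->|/eqP->]; [left|rewrite (negPf nac)|right].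
by exists X.
Qed.

(* Otherwise the arc from [w] to [u] that [v] does not touch continues along a hole
   through [v] and [w]; avoiding a hole through both [u] and [v] makes [u] adjacent
   to both neighbours of [v] on it, and bypassing [v] via [u] contradicts NC. *)
Lemma new_edge_adj G C u v w : NC_set G C -> u \in C -> v \in C -> adj G u v ->
  on_hole_with G u w -> ~~ adj G u w -> v != w ->
  adj G v w || on_hole_with G v w -> adj G v w.
Proof.
move=> nc uC vC uv /on_hole_withP[wu [H [hH uH wH]]] nuw vw.
case/orP=> // /on_hole_withP[_ [H3 [hH3 vH3 wH3]]].
case nvw : (adj G v w) => //; move/negbT: nvw => nvw; exfalso.
have uv' := adj_neq uv.
have uw : u != w by rewrite eq_sym.
have [A [B hAB]] := hole_arcs hH uH wH uw nuw.
have ntw v' : w != v' -> ~~ adj G v' w -> ~ touch G [set w] [set v'].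
  by move=> wv nv [p [q [/set1P-> /set1P->]]]; rewrite (negPf wv) adjC (negPf nv).
suff main A' B' : arcs G H u w A' B' -> touch G A' [set v].
  apply: (NC_arcs (nc.1 _ uC) hH uw hAB (@conn_set1 _ v)).
  - by rewrite inE.
  - by apply: ntw => //; rewrite eq_sym.
  - exact: main hAB.
  - exact: main (arcsC hAB).
case=> -[a [c [[uA wA cA] [aA ua uniqa] [cc wc uc]]]] _ _ _.
case: (asboolP (touch G A' [set v])) => // nt; exfalso.
have [A3 [B3 hAB3]] := hole_arcs hH3 vH3 wH3 vw nvw.
have uH3 : u \notin H3.
  by apply: contra uv' => uH3; rewrite (NC_set_uniq nc hH3 uH3 vH3 uC vC).
suff main A4 B4 : arcs G H3 v w A4 B4 -> touch G A4 [set u].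
  apply: (NC_arcs (nc.1 _ vC) hH3 vw hAB3 (@conn_set1 _ u)).
  - by rewrite inE eq_sym.
  - by apply: ntw.
  - exact: main hAB3.
  - exact: main (arcsC hAB3).
case=> -[a4 [c4 [[vA4 wA4 cA4] [aA4 va4 uniqa4] [cc4 wc4 uc4]]]] _ _ eH3.
case ua4 : (adj G a4 u); first by apply: touch_adj ua4; rewrite ?inE.
exfalso; move/negbT: ua4 => ua4.
have ua4' : u != a4.
  by apply: contraNneq uH3 => ->; rewrite eH3 !inE aA4 !orbT.
(* This runs from [u] along [A'] to [w] and back along [A4] towards [v]; only [u] and [a4] in it are
   adjacent to [v]. Closing up through [v] gives a hole with both [u] and [v] in [C]. *)
pose S := [set u] :|: A' :|: ([set w] :|: A4).
have [|||||||X [hX [vX uX _] _ _]] := @hole_of_conn G S v u a4 _ _ _ _ _ va4 ua4'.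
- rewrite !inE [v == u]eq_sym (negPf uv') (negPf vw) (negPf vA4) /= orbF.
  by apply/negP=> vA; apply: nt; apply: (@touch_eq _ _ _ v); rewrite ?inE.
- by rewrite !inE eqxx.
- by rewrite !inE aA4 !orbT.
- apply: conn_setU.
  + by apply: conn_setU => //; [apply: conn_set1 | apply: touch_adj ua; rewrite ?inE].
  + by apply: conn_setU => //; [apply: conn_set1 | apply: touch_adj wc4; rewrite ?inE].
  + by apply: touchC; apply: touch_adj wc; rewrite !inE ?eqxx ?cc ?orbT.
- by rewrite adjC.
- by rewrite adjC.
- move=> x; rewrite !inE -!orbA.
  case/or4P=> [/eqP->|xA|/eqP->|xA4 /(uniqa4 _ xA4)];
    [by left | | by rewrite (negPf nvw) | by right].
  by move=> vx; case: nt; apply: touchC; apply: touch_adj vx; rewrite ?inE.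
by rewrite (NC_set_uniq nc hX uX vX uC vC) eqxx in uv'.
Qed.

(** The added edges inside [K] pairwise meet, and each has exactly one end in [C]; so they form a
    star, whose centre is the vertex to remove. *)
Lemma clique_hatG G C K : NC_set G C -> clique (hatG G C) K ->
  exists2 S : {set T}, #|S| <= 1 & clique G (K :\: S).
Proof.
move=> nc /cliqueP[]; rewrite gV_hatG => sK adjK.
pose new u w := [&& u \in K, w \in K, u \in C, on_hole_with G u w & ~~ adj G u w].
have newC u w : new u w -> w \notin C.
  case/and5P=> _ _ uC /on_hole_withP[wu [H [hH uH wH]]] _.
  by apply: contra wu => wC; rewrite (NC_set_uniq nc hH wH uH wC uC).
(* For disjoint added edges, [new_edge_adj] makes the cross pairs edges of [G]; then [u1 u2 w1 w2]
   is a 4-hole with two vertices of [C]. *)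
have new_meet u1 w1 u2 w2 : new u1 w1 -> new u2 w2 -> u1 != u2 -> w1 = w2.
  move=> n1 n2 u12; apply/eqP/negPn/negP=> w12.
  have w1C := newC _ _ n1; have w2C := newC _ _ n2.
  have [u1K w1K u1C h1 nu1] := and5P n1; have [u2K w2K u2C h2 nu2] := and5P n2.
  have nh x y : y \in C -> x \in C -> ~~ on_hole_with G x y.
    move=> yC xC; apply/negP=> /on_hole_withP[yx [H [hH xH yH]]].
    by rewrite (NC_set_uniq nc hH yH xH yC xC) eqxx in yx.
  have uu : adj G u1 u2.
    have := adjK _ _ u1K u2K u12; rewrite adj_hatG //.
    by rewrite (negPf (nh _ _ u2C u1C)) (negPf (nh _ _ u1C u2C)) !andbF !orbF.
  have ww : adj G w1 w2.
    by have := adjK _ _ w1K w2K w12; rewrite adj_hatG // (negPf w1C) (negPf w2C) !orbF.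
  have cross u w : u \in K -> w \in K -> u \in C -> w \notin C ->
      (u != w) /\ (adj G u w || on_hole_with G u w).
    move=> uK wK uC wC; have uw : u != w by apply: contraTneq uC => ->.
    by split=> //; have := adjK _ _ uK wK uw; rewrite adj_hatG // uC (negPf wC) orbF.
  have [u2w1 /(new_edge_adj nc u1C u2C uu h1 nu1 u2w1) a21] := cross _ _ u2K w1K u2C w1C.
  rewrite adjC in uu.
  have [u1w2 /(new_edge_adj nc u2C u1C uu h2 nu2 u1w2) a12] := cross _ _ u1K w2K u1C w2C.
  rewrite adjC in uu.
  have [|||X [hX u1X u2X]] := hole_C4 uu a21 ww _ _ _ nu1 nu2.
  - by rewrite adjC.
  - by apply: contraTneq u1C => ->.
  - by apply: contraTneq u2C => ->.
  by rewrite (NC_set_uniq nc hX u1X u2X u1C u2C) eqxx in u12.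
have clD (S : {set T}) : (forall u w, new u w -> (u \in S) || (w \in S)) -> clique G (K :\: S).
  move=> cov; apply/cliqueP; split; first by apply: subset_trans (subsetDl _ _) sK.
  have half x y : x \notin S -> y \notin S -> x \in K -> y \in K -> x \in C ->
      on_hole_with G x y -> adj G x y.
    move=> xS yS xK yK xC hxy; apply/negPn/negP=> nxy.
    have /cov : new x y by rewrite /new xK yK xC hxy.
    by rewrite (negPf xS) (negPf yS).
  move=> x y /setDP[xK xS] /setDP[yK yS] xy.
  have := adjK _ _ xK yK xy; rewrite adj_hatG // => /or3P[//|/andP[]|/andP[]].
    exact: half.
  by rewrite adjC; apply: half.
case: (boolP [exists p : T * T, new p.1 p.2]) => [/existsP[[u w] /= n1]|/existsPn no]; last first.
  by exists set0; rewrite ?cards0 //; apply: clD => u w n1; have := no (u, w); rewrite /= n1.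
(* The centre of the star is [u] if all added edges start there; otherwise a second start [u2]
   forces [w] to be their common end. *)
have [/forallP h|/forallPn[[u2 w2] /=]] := boolP [forall p : T * T, new p.1 p.2 ==> (p.1 == u)].
  exists [set u]; rewrite ?cards1 //; apply: clD => u' w' n'.
  by have /implyP/(_ n') := h (u', w'); rewrite inE /= => ->.
rewrite negb_imply => /andP[n2 u2u].
exists [set w]; rewrite ?cards1 //; apply: clD => u3 w3 n3; rewrite !inE; apply/orP; right.
case: (eqVneq u3 u) => [e|u3u]; last by rewrite (new_meet _ _ _ _ n3 n1 u3u).
rewrite eq_sym in u2u; rewrite (new_meet _ _ _ _ n1 n2 u2u).
by rewrite -e in u2u; rewrite (new_meet _ _ _ _ n3 n2 u2u).
Qed.

(** * Vertices on no hole *)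

(** This ranges over the whole type; elements outside [gV G] are isolated and form components of
    their own. *)
Definition nonnbr G x : {set T} := [set v | (v != x) && ~~ adj G x v].
Definition comp G x d : {set T} := [set v | connect (inner G (nonnbr G x)) d v].
Definition bag G x d : {set T} :=
  [set v | (v \in comp G x d) || [exists q in comp G x d, adj G v q]].

Lemma comp_refl G x d : d \in comp G x d.
Proof. by rewrite inE connect0. Qed.

Lemma comp_sub G x d : d \in nonnbr G x -> comp G x d \subset nonnbr G x.
Proof.
move=> dR; apply/subsetP=> v; rewrite [v \in comp _ _ _]inE => /connectP[p pp ->] {v}.
by elim: p d dR pp => //= v p IH d dR /andP[/and3P[_ vR _] pp]; apply: IH pp.
Qed.

Lemma comp_eq G x d d' v : v \in comp G x d -> v \in comp G x d' ->
  comp G x d = comp G x d'.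
Proof.
have sym := sym_connect_sym (@inner_sym G (nonnbr G x)).
rewrite !inE => dv d'v; apply/setP=> w; rewrite !inE.
by rewrite (same_connect sym dv) (same_connect sym d'v).
Qed.

Lemma conn_comp G x d : conn_set G (comp G x d).
Proof.
have sym := sym_connect_sym (@inner_sym G (comp G x d)).
suff con v : v \in comp G x d -> connect (inner G (comp G x d)) d v.
  by move=> v w /con dv /con dw; apply: connect_trans dw; rewrite sym.
have con p w : w \in comp G x d -> path (inner G (nonnbr G x)) w p ->
    connect (inner G (comp G x d)) w (last w p).
  elim: p w => //= v' p IH w wC /andP[wv pp].
  have vC : v' \in comp G x d.
    by move: wC; rewrite !inE => wC; apply: connect_trans wC (connect1 wv).
  apply: connect_trans (IH _ vC pp); apply: connect1; rewrite /inner /= wC vC.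
  by case/and3P: wv.
by rewrite [v \in _]inE => /connectP[p pp ->]; apply: con pp; apply: comp_refl.
Qed.

Lemma bag_adj G x d v a : v \in comp G x d -> adj G v a -> a \in bag G x d.
Proof.
move=> vC va; rewrite inE; apply/orP; right; apply/exists_inP; exists v => //.
by rewrite adjC.
Qed.

Lemma comp_bag G x d : comp G x d \subset bag G x d.
Proof. by apply/subsetP=> v vC; rewrite inE vC. Qed.

Lemma bag_out G x d v : d \in nonnbr G x -> v \in bag G x d -> v \notin comp G x d ->
  adj G x v /\ touch G [set v] (comp G x d).
Proof.
move=> dR; rewrite [v \in bag _ _ _]inE => /orP[->//|/exists_inP[q qC vq]] vC.
have := subsetP (comp_sub dR) _ qC; rewrite inE => /andP[qx nq].
split; last by apply: touch_adj vq; rewrite ?in_set1.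
apply: contraNT vC => nv.
have vx : v != x by apply: contraNneq nq => <-.
move: qC; rewrite !inE => dq; apply: connect_trans dq (connect1 _).
by rewrite /inner /= !inE qx nq vx nv adjC.
Qed.

Lemma bag_notin G x d : d \in nonnbr G x -> x \notin bag G x d.
Proof.
move=> dR; apply/negP=> xB; have [|/(bag_out dR xB)[]] := boolP (x \in comp G x d).
  by move/(subsetP (comp_sub dR)); rewrite inE eqxx.
by rewrite adjxx.
Qed.

(** Two nonadjacent vertices attached to the component are both neighbours of [x]; an induced path
    between them through the component would close up to a hole through [x]. *)
Lemma bag_clique G x d p q : (forall X, is_hole G X -> x \notin X) ->
  d \in nonnbr G x -> p \in bag G x d -> q \in bag G x d ->
  p \notin comp G x d -> q \notin comp G x d -> p != q -> adj G p q.
Proof.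
move=> nh dR pB qB pC qC pq; apply/negPn/negP=> npq.
have [xp tp] := bag_out dR pB pC; have [xq tq] := bag_out dR qB qC.
have sC v : v \in comp G x d -> (v != x) && ~~ adj G x v.
  by move/(subsetP (comp_sub dR)); rewrite inE.
have [|||||X [hX [xX _ _] _ _]] :=
  @hole_of_conn G ([set p] :|: comp G x d :|: [set q]) x p q _ _ _ _ xp xq pq npq.
- rewrite 2!in_setU !in_set1 (negPf (adj_neq xp)) (negPf (adj_neq xq)) /= orbF.
  by apply/negP=> /sC; rewrite eqxx.
- by rewrite !inE eqxx.
- by rewrite !inE eqxx !orbT.
- apply: conn_setU; [apply: conn_setU => // | exact: conn_set1 |].
  + exact: conn_set1.
  + exact: conn_comp.
  + by apply: touchC; apply: touchS tq => //; apply: subsetUr.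
- move=> v; rewrite 2!in_setU !in_set1 -orbA.
  by case/or3P=> [/eqP->|/sC/andP[_ /negPf->]|/eqP->] //; [left|right].
by have := nh _ hX; rewrite xX.
Qed.

(* If [x] lies on no hole, the edges created around [x] stay within the
   neighbourhood of [x] or within one bag. *)
Definition linked G x a b : bool :=
  if a == x then adj G x b else if b == x then adj G x a else
  (adj G x a && adj G x b) ||
  [exists d in nonnbr G x, (a \in bag G x d) && (b \in bag G x d)].

Lemma linkedC G x a b : linked G x a b = linked G x b a.
Proof.
rewrite /linked; case: (eqVneq a x) => [->|ax]; case: (eqVneq b x) => [e|bx];
  rewrite ?e ?eqxx //.
rewrite andbC; congr (_ || _).
by apply/exists_inP/exists_inP=> -[d dR]; rewrite andbC => h; exists d.
Qed.

Lemma bag_linked G x d a b : d \in nonnbr G x -> a \in bag G x d -> b \in bag G x d ->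
  linked G x a b.
Proof.
move=> dR aB bB; have nx v : v \in bag G x d -> (v == x) = false.
  by move=> vB; apply: contraTF vB => /eqP->; apply: bag_notin.
by rewrite /linked !nx //; apply/orP; right; apply/exists_inP; exists d; rewrite ?aB.
Qed.

(** An edge avoiding [x] with an end outside the neighbourhood of [x] lies in the bag of the
    component of that end. *)
Lemma adj_linked G x a b : adj G a b -> linked G x a b.
Proof.
move=> ab; rewrite /linked; case: (eqVneq a x) => [<-//|ax].
case: (eqVneq b x) => [<-|bx]; first by rewrite adjC.
have [xa|nxa] /= := boolP (adj G x a); last first.
  apply/exists_inP; exists a; first by rewrite inE ax.
  by rewrite (bag_adj (comp_refl _ _ _) ab) (subsetP (comp_bag _ _ _)) // comp_refl.
have [//|nxb] /= := boolP (adj G x b).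
apply/exists_inP; exists b; first by rewrite inE bx.
rewrite adjC in ab.
by rewrite (bag_adj (comp_refl _ _ _) ab) (subsetP (comp_bag _ _ _)) // comp_refl.
Qed.

Lemma linked_comp G x d a b : d \in nonnbr G x -> a \in comp G x d -> linked G x a b ->
  b \in bag G x d.
Proof.
move=> dR aC; have := subsetP (comp_sub dR) _ aC; rewrite inE => /andP[ax nxa].
rewrite /linked (negPf ax) (negPf nxa); case: ifP => // _ /= /exists_inP[d' d'R /andP[aB bB]].
have [aC'|/(bag_out d'R aB)[]] := boolP (a \in comp G x d'); last by rewrite (negPf nxa).
by rewrite /bag (comp_eq aC aC').
Qed.

(** Either [X] lies in the neighbourhood of [x], or it has a vertex [d] outside the closed
    neighbourhood. In the second case [X] stays in the bag of [d]: the two arcs to a vertex outside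
    would both leave the component through its boundary, which is a clique and would give a
    chord. *)
Lemma linked_hole G Gs x X : (forall X', is_hole G X' -> x \notin X') ->
  (forall a b, adj Gs a b -> linked G x a b) ->
  {in gV Gs &, forall a b, adj G a b -> adj Gs a b} ->
  is_hole Gs X -> {in X &, forall a b, linked G x a b} /\ x \notin X.
Proof.
move=> nh lk sG hX; have /subsetP sX := hole_gV hX.
have [/forall_inP XN|] := boolP [forall v in X, adj G x v].
  have xX : x \notin X by apply/negP=> /XN; rewrite adjxx.
  split=> // a b aX bX; rewrite /linked !XN //.
  have nx v : v \in X -> (v == x) = false by apply: contraTF => /eqP->.
  by rewrite !nx.
rewrite negb_forall_in => /exists_inP[d0 d0X nxd0].
have [d dX dR] : exists2 d, d \in X & d \in nonnbr G x.
  (* The vertex found may be [x] itself; then a vertex of the hole not adjacent to [x] in [Gs]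
     serves instead. *)
  have [e|d0x] := eqVneq d0 x; last by exists d0; rewrite // inE d0x.
  rewrite {}e in d0X; have [y [z [Q [[_ _ sQ] _ [_ /set0Pn[q qQ] xQ nQ] _]]]] := hole_neighbours hX d0X.
  have qX := subsetP sQ _ qQ; exists q => //; rewrite inE; apply/andP; split.
    by apply: contraNneq xQ => <-.
  by apply: contra (nQ _ qQ); apply: sG; apply: sX.
suff sXB : X \subset bag G x d.
  split; last by apply: contra (bag_notin dR) => /(subsetP sXB).
  by move=> a b /(subsetP sXB) aB /(subsetP sXB) bB; apply: bag_linked aB bB.
apply/subsetP=> v vX; apply/negPn/negP=> vB.
have dv : d != v.
  by apply: contraNneq vB => <-; rewrite (subsetP (comp_bag _ _ _)) ?comp_refl.
have ndv : ~~ adj Gs d v.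
  by apply: contra vB => /lk; apply: linked_comp => //; apply: comp_refl.
have [A [B hAB]] := hole_arcs hX dX vX dv ndv.
have main A' B' : arcs Gs X d v A' B' ->
    exists p, [/\ p \in A', p \in bag G x d & p \notin comp G x d].
  case=> -[a [c [[dA vA cA] [aA da _] [cc vc _]]]] _ _ _.
  case: (boolP [exists p in A', (p \in bag G x d) && (p \notin comp G x d)]).
    by case/exists_inP=> p pA /andP[pB pC]; exists p.
  rewrite negb_exists_in => /forall_inP nA; exfalso.
  have AC p : p \in A' -> p \in bag G x d -> p \in comp G x d.
    by move=> pA pB; have := nA _ pA; rewrite pB negbK.
  have aC : a \in comp G x d.
    by apply: AC => //; apply: linked_comp (lk _ _ da) => //; apply: comp_refl.
  have cC : c \in comp G x d.
    have /connectP[p pp ->] := cA _ _ aA cc.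
    elim: p a aC pp {aA da} => //= b p IH a aC /andP[/and3P[_ bA ab]].
    by apply: IH; apply: AC => //; apply: linked_comp (lk _ _ ab).
  by case/negP: vB; apply: linked_comp (dR) cC _; apply: lk; rewrite adjC.
have [p [pA pB pC]] := main _ _ hAB; have [q [qA qB qC]] := main _ _ (arcsC hAB).
case: hAB => _ _ nt eX; apply: nt; exists p, q; split=> //.
case: (eqVneq p q) => //= pq; apply: sG; try by apply: sX; rewrite eX !inE ?pA ?qA ?orbT.
exact: (bag_clique nh dR).
Qed.

(** * Simplicial vertices and DP-colouring *)

Lemma adj_induced G X x y : adj (induced G X) x y = [&& x \in X, y \in X & adj G x y].
Proof.
rewrite {1}/adj !inE /= (adjC G y x) orbb.
case h: (adj G x y); last by rewrite !andbF.
by rewrite !(adj_gV h) (adj_neq h) !andbT.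
Qed.

Lemma chordal_induced G X : chordal G -> chordal (induced G X).
Proof.
move=> cG Y hY; apply: (cG Y).
have sY := hole_gV hY; rewrite /= subsetI in sY; case/andP: sY => /subsetP sYX sYG.
apply: eq_graph_hole (hY) => // x y /sYX xX /sYX yX.
by rewrite adj_induced xX yX.
Qed.

Definition simplicial G v : Prop :=
  forall a b, adj G v a -> adj G v b -> a != b -> adj G a b.

(** Induction on the number of vertices, applied to the bag of [w], which misses [x]. A vertex of
    the component has all its neighbours in the bag, so being simplicial there is enough. *)
Lemma simplicial_far G x w : chordal G -> x \in gV G -> w \in gV G ->
  w \in nonnbr G x -> exists v, [/\ v \in gV G, v \in nonnbr G x & simplicial G v].
Proof.
move: {2}#|gV G|.+1 (ltnSn #|gV G|) => k.
elim: k G x w => // k IH G x w; rewrite ltnS => lek cG xG wG wR.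
set B := bag G x w; set G' := induced G B.
have nh X : is_hole G X -> x \notin X by move/cG.
have mB v : v \in comp G x w -> v \in B by apply/subsetP/comp_bag.
have lift v : v \in gV G -> v \in comp G x w -> simplicial G' v ->
    exists v, [/\ v \in gV G, v \in nonnbr G x & simplicial G v].
  move=> vG vC sv; exists v; split=> //; first exact: (subsetP (comp_sub wR)).
  move=> a b va vb ab; have := sv a b; rewrite !adj_induced va vb mB // ab.
  by rewrite !(bag_adj vC) // => /(_ isT isT isT).
have cG' : chordal G' by apply: chordal_induced.
have ltG' : #|gV G'| < k.
  apply: leq_trans lek; apply: proper_card; apply/properP; split; first exact: subsetIr.
  by exists x => //; rewrite inE negb_and bag_notin.
have IH' p v : p \in gV G' -> v \in gV G' -> v != p -> ~~ adj G p v ->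
    exists v, [/\ v \in gV G, v \in B, v != p, ~~ adj G p v & simplicial G' v].
  move=> pG vG vp npv; have [|v' [vG' vR sv]] := IH G' p v ltG' cG' pG vG.
    by rewrite inE vp adj_induced (negPf npv) !andbF.
  case/setIP: vG' => v'B v'G; case/setIP: pG => pB _.
  move: vR; rewrite in_set adj_induced v'B pB => /andP[v'p nv'].
  by exists v'.
(* If a boundary vertex [p] misses some vertex of the bag, induction from [p] yields a simplicial
   vertex not adjacent to [p]; it lies in the component because the boundary is a clique. *)
have [/exists_inP[p pG /exists_inP[v vG /and3P[pC vp npv]]]|/exists_inPn univ] :=
  boolP [exists p in gV G', exists v in gV G',
           [&& p \notin comp G x w, v != p & ~~ adj G p v]].
  have [v' [v'G v'B v'p npv' sv']] := IH' _ _ pG vG vp npv.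
  apply: (lift v') => //; apply: contraNT npv' => v'C.
  by apply: bag_clique nh wR _ v'B pC v'C _; [case/setIP: pG | rewrite eq_sym].
have univ' p v : p \in gV G' -> v \in gV G' -> p \notin comp G x w -> v != p -> adj G p v.
  move=> pG vG pC vp; apply/negPn/negP=> npv.
  by have /exists_inPn/(_ v vG) := univ p pG; rewrite pC vp npv.
(* Now boundary vertices are adjacent to the whole bag, so a simplicial vertex with a non-neighbour
   in the bag is in the component. If the bag is a clique, [w] itself will do. *)
have [/exists_inP[p pG /exists_inP[v vG /andP[vp npv]]]|/exists_inPn full] :=
  boolP [exists p in gV G', exists v in gV G', (v != p) && ~~ adj G p v].
  have [v' [v'G v'B v'p npv' sv']] := IH' _ _ pG vG vp npv.
  apply: (lift v') => //; apply: contraNT npv' => v'C.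
  by rewrite adjC; apply: univ' => //; [apply/setIP | rewrite eq_sym].
apply: (lift w) => //; first exact: comp_refl.
move=> a b; rewrite !adj_induced => /and3P[_ aB wa] /and3P[_ bB wb] ab.
rewrite aB bB /=; apply/negPn/negP=> nab.
have aG : a \in gV G' by rewrite in_setI aB (adj_gV wa).
have /exists_inPn/(_ b) := full a aG.
by rewrite in_setI bB (adj_gV wb) eq_sym ab nab => /(_ isT).
Qed.

Lemma chordal_simplicial G x : chordal G -> x \in gV G ->
  exists2 v, v \in gV G & simplicial G v.
Proof.
move=> cG xG.
have [/exists_inP[p pG /exists_inP[v vG /andP[vp npv]]]|/exists_inPn full] :=
  boolP [exists p in gV G, exists v in gV G, (v != p) && ~~ adj G p v].
  have [|v' [v'G _ sv]] := simplicial_far cG pG vG; first by rewrite inE vp.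
  by exists v'.
exists x => // a b xa xb ab; apply/negPn/negP=> nab.
have /exists_inPn/(_ b) := full a (adj_gV xa).2.
by rewrite (adj_gV xb) eq_sym ab nab => /(_ isT).
Qed.

Lemma leq_omega G K : clique G K -> #|K| <= omega G.
Proof. by move=> cK; apply: (@leq_bigmax_cond _ _ (fun K : {set T} => #|K|)). Qed.

Lemma omega_induced G X : omega (induced G X) <= omega G.
Proof.
apply/bigmax_leqP=> K /cliqueP[sK aK]; apply: leq_omega; apply/cliqueP; split.
  exact: subset_trans sK (subsetIr _ _).
by move=> x y xK yK xy; have := aK _ _ xK yK xy; rewrite adj_induced => /and3P[].
Qed.

(** A simplicial vertex together with its neighbours is a clique, so it has fewer than [k]
    neighbours. Each of them forbids at most one colour, and a colouring of the rest extends. *)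
Lemma chordal_dp_colorable G k : chordal G -> omega G <= k -> dp_colorable G k.
Proof.
move: {2}#|gV G|.+1 (ltnSn #|gV G|) => n.
elim: n G => // n IH G; rewrite ltnS => len cG ok M [Msym Mmat].
have [x xG|V0] := pickP (mem (gV G)); last first.
  exists (fun=> 0); split=> [v vG|u v /adj_gV[uG _]].
    by have := V0 v; rewrite inE /= vG.
  by have := V0 u; rewrite inE /= uG.
have [v vG sv] := chordal_simplicial cG xG.
pose G' := delete G [set v].
have adjG' a b : adj G' a b = [&& a != v, b != v & adj G a b].
  rewrite adj_induced !inE; case h: (adj G a b); last by rewrite !andbF.
  by rewrite !(adj_gV h) !andbT.
have [||||f [fk fM]] := IH G' _ _ _ M.
- apply: leq_trans len; apply: proper_card; apply/properP; split; first exact: subsetIr.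
  by exists v => //; rewrite !inE eqxx.
- exact: chordal_induced.
- exact: leq_trans (omega_induced _ _) ok.
- split=> // a b c d d'; rewrite adjG' => /and3P[_ _]; exact: Mmat.
pose N := [set w | adj G v w].
have Nk : #|N| < k.
  have vN : v \notin N by rewrite inE adjxx.
  have := cardsU1 v N; rewrite vN add1n => <-; apply: leq_trans ok; apply: leq_omega.
  apply/cliqueP; split.
    by apply/subsetP=> w; rewrite !inE => /predU1P[->//|/adj_gV[]].
  move=> a b; rewrite !inE => /predU1P[->|va] /predU1P[->|vb] // ab.
  - by rewrite eqxx in ab.
  - by rewrite adjC.
  - exact: sv.
have Nf w : w \in N -> f w < k.
  rewrite inE => vw; apply: fk; rewrite !inE (adj_gV vw) !andbT.
  by rewrite eq_sym (adj_neq vw).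
pose blocks (w : T) (c : 'I_k) := (w \in N) && M w v (f w) c.
pose Bl := [set c : 'I_k | [exists w, blocks w c]].
(* This sends a forbidden colour to a neighbour forbidding it, injectively by the matching
   condition; the default [v] occurs only at free colours. *)
pose h (c : 'I_k) := odflt v [pick w | blocks w c].
have hB (c : 'I_k) : c \in Bl -> blocks (h c) c.
  rewrite inE /h; case: pickP => //= no /existsP[w]; by rewrite no.
have hinj : {in Bl &, injective h}.
  move=> c c' /hB/andP[hN Mc] /hB/andP[_ Mc'] e; apply/val_inj.
  rewrite -e in Mc'; apply: Mmat Mc Mc' => //; last exact: Nf.
  by rewrite adjC; rewrite inE in hN.
have [c cB] : exists c : 'I_k, c \notin Bl.
  apply/existsP; rewrite -negb_forall; apply: contraTN Nk => /forallP all.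
  rewrite -leqNgt -[k in k <= _]card_ord -(@card_in_imset _ _ h 'I_k); last first.
    by move=> c c' _ _; apply: hinj.
  apply: subset_leq_card; apply/subsetP=> w /imsetP[c _ ->].
  by case/andP: (hB _ (all c)).
have cM w : adj G v w -> ~~ M w v (f w) c.
  move=> vw; apply: contra cB => Mc; rewrite inE; apply/existsP; exists w.
  by rewrite /blocks inE vw.
exists (fun u => if u == v then val c else f u); split=> [u uG|a b ab].
  case: eqP => [_|/eqP uv]; first exact: ltn_ord.
  by apply: fk; rewrite !inE uv uG.
case: (eqVneq a v) => [ea|av]; case: (eqVneq b v) => [eb|bv].
- by rewrite ea eb adjxx in ab.
- by rewrite ea Msym cM // -ea.
- by rewrite eb cM // -eb adjC.
- by apply: fM; rewrite adjG' av bv.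
Qed.

(** A cover of [G] becomes one of [Gs] by taking empty matchings outside the edges of [G]. *)
Lemma dp_colorable_sub G Gs k : gV Gs = gV G -> (forall x y, adj G x y -> adj Gs x y) ->
  dp_colorable Gs k -> dp_colorable G k.
Proof.
move=> eV sG dp M [Msym Mmat].
have [|f [fk fM]] := dp (fun u v (a b : nat) => adj G u v && M u v a b).
  split=> [u v a b|u v a b b' _ ak bk bk' /andP[uv Mb] /andP[_ Mb']].
    by rewrite adjC Msym.
  exact: Mmat Mb Mb'.
exists f; split=> [v|u v uv]; first by rewrite -eV; apply: fk.
by have := fM u v (sG _ _ uv); rewrite uv.
Qed.

Lemma chiDP_exists G k : dp_colorable G k -> exists2 j, chiDP G j & j <= k.
Proof.
move=> dpk; have ex : exists j, asbool (dp_colorable G j) by exists k; apply/asboolP.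
case: (ex_minnP ex) => j /asboolP dpj minj; exists j; last by apply: minj; apply/asboolP.
by split=> // i dpi; apply: minj; apply/asboolP.
Qed.

(** * Local chordalization partitions *)

Lemma mem_bigcup_seq (P : seq {set T}) x :
  (x \in \bigcup_(D <- P) D) = has (fun D : {set T} => x \in D) P.
Proof. by elim: P => [|D P IH]; rewrite ?big_nil ?big_cons !inE ?IH. Qed.

(* [R] is the union of the parts still to be added, [l] the number of parts done. *)
Definition lc_inv G Gs R l : Prop :=
  [/\ gV Gs = gV G :\: R, {in gV Gs &, forall a b, adj G a b -> adj Gs a b},
      (forall x, (forall X, is_hole G X -> x \notin X) ->
         forall a b, adj Gs a b -> linked G x a b) &
      forall K, clique Gs K -> exists2 S : {set T}, #|S| <= l & clique G (K :\: S)].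

Lemma lc_inv_delete G R : lc_inv G (delete G R) R 0.
Proof.
have eV : gV (delete G R) = gV G :\: R by apply: setIidPl; apply: subsetDl.
split=> //.
- by move=> a b; rewrite eV => aV bV ab; rewrite adj_induced aV bV.
- by move=> x _ a b; rewrite adj_induced => /and3P[_ _]; apply: adj_linked.
move=> K /cliqueP[sK aK]; exists set0; rewrite ?cards0 // setD0; apply/cliqueP; split.
  exact: subset_trans sK (subsetIr _ _).
by move=> x y xK yK xy; have := aK _ _ xK yK xy; rewrite adj_induced => /and3P[].
Qed.

(** Edges added around a vertex on no hole of [G] remain linked by [linked_hole], and [clique_hatG]
    costs one more vertex of a clique. *)
Lemma lc_inv_step G Gs C R l :
  lc_inv G Gs (C :|: R) l -> C \subset gV G -> [disjoint C & R] ->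
  let Gi := Graph (gV Gs :|: C) (fun x y => adj Gs x y || adj (delete G R) x y) in
  NC_set Gi C -> lc_inv G (hatG Gi C) R l.+1.
Proof.
move=> [eV sG lk cl] sC dCR Gi nc.
have eVi : gV Gi = gV G :\: R.
  apply/setP=> x; rewrite /= eV !inE; have [xC|xC] := boolP (x \in C).
    by rewrite (subsetP sC) // (disjointFr dCR xC) orbT.
  by rewrite orbF.
have adjGi x y : adj Gi x y = adj Gs x y || adj (delete G R) x y.
  rewrite adjE !(adjC _ y x) orbb; case: (boolP (_ || _)) => [h|_]; last by rewrite !andbF.
  rewrite andbT; case/orP: h => h; first by rewrite !inE !(adj_gV h) (adj_neq h).
  have /subsetP sV : gV (delete G R) \subset gV Gi by rewrite eVi subsetIl.
  by rewrite (adj_neq h) !(sV _ (adj_gV h).1) !(sV _ (adj_gV h).2).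
have sGi : {in gV Gi &, forall a b, adj G a b -> adj Gi a b}.
  by move=> a b; rewrite eVi => aV bV ab; rewrite adjGi adj_induced aV bV ab orbT.
have lki x : (forall X, is_hole G X -> x \notin X) ->
    forall a b, adj Gi a b -> linked G x a b.
  move=> nh a b; rewrite adjGi => /orP[/(lk _ nh)//|]; rewrite adj_induced.
  by case/and3P=> _ _; apply: adj_linked.
split.
- by rewrite gV_hatG.
- move=> a b; rewrite gV_hatG => aV bV ab; rewrite adj_hatG //.
  by rewrite sGi.
- move=> x nh a b; rewrite adj_hatG //.
  have hl u w : on_hole_with Gi u w -> linked G x u w.
    case/on_hole_withP=> _ [H [hH uH wH]].
    by have [h _] := linked_hole nh (lki x nh) sGi hH; apply: h.
  case/or3P=> [/(lki _ nh)//|/andP[_ /hl]//|/andP[_ /hl]]; by rewrite linkedC.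
move=> K /(clique_hatG nc)[S1 S1c /cliqueP[sK aK]].
(* Vertices of [C] are absent from [Gs], so they are set aside here. They need not be removed in the
   end: edges of [Gi] at [C] come from [G]. *)
have [|S2 S2c /cliqueP[sK' aK']] := cl ((K :\: S1) :\: C).
  apply/cliqueP; split.
    apply/subsetP=> x /setDP[xK xC]; have := subsetP sK _ xK.
    by rewrite /= inE (negPf xC) orbF.
  move=> x y /setDP[xK xC] /setDP[yK yC] xy; have := aK _ _ xK yK xy.
  rewrite adjGi => /orP[//|h]; apply: sG; last by move: h; rewrite adj_induced => /and3P[].
    have := subsetP sK _ xK; by rewrite /= inE (negPf xC) orbF.
  have := subsetP sK _ yK; by rewrite /= inE (negPf yC) orbF.
exists (S1 :|: S2).
  by rewrite (leq_trans (leq_card_setU _ _)) // -add1n leq_add.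
rewrite setDUr; apply/cliqueP; split.
  apply: subset_trans (subsetIl _ _) _; apply: subset_trans sK _.
  by rewrite eVi subsetDl.
have GsC x y : adj Gs x y -> x \notin C.
  by case/adj_gV; rewrite eV !inE negb_or -andbA => /and3P[].
move=> x y; rewrite !in_setI => /andP[xK1 /setDP[xK xS]] /andP[yK1 /setDP[yK yS]] xy.
have := aK _ _ xK1 yK1 xy; rewrite adjGi => /orP[h|]; last first.
  by rewrite adj_induced => /and3P[].
apply: aK' => //; apply/setDP; split=> //; apply/setDP; split=> //; first exact: GsC h.
by rewrite adjC in h; apply: GsC h.
Qed.

(** Chordality of the current graph is supplied by the last step performed, so it has to be assumed
    when no part is left. *)
Lemma lcp_ok_completion G Gs (P : seq {set T}) l :
  lc_inv G Gs (\bigcup_(D <- P) D) l -> \bigcup_(D <- P) D \subset gV G ->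
  (forall i j, i < j < size P -> [disjoint nth set0 P i & nth set0 P j]) ->
  (P = [::] -> chordal Gs) -> lcp_ok G Gs P ->
  exists2 G', lc_inv G G' set0 (l + size P) & chordal G'.
Proof.
elim: P Gs l => [|C P IH] Gs l.
  by rewrite big_nil addn0 => inv _ _ cG _; exists Gs => //; apply: cG.
rewrite big_cons subUset => inv /andP[sC sP] dis _ /= [_ nc cG ok].
have dCR : [disjoint C & \bigcup_(D <- P) D].
  rewrite disjoints_subset; apply/subsetP=> x xC; rewrite inE mem_bigcup_seq.
  apply/hasPn=> D /(nthP set0)[i iP <-].
  by have := dis 0 i.+1; rewrite /= ltnS iP => /(_ isT)/disjointFr->.
have inv' := lc_inv_step inv sC dCR nc.
rewrite addnS -addSn; apply: IH inv' sP _ _ ok => // i j ij.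
by apply: (dis i.+1 j.+1).
Qed.

(** * From large cliques of the completion to the forbidden join *)

Lemma lc_inv_clique G G' (m n k : nat) K : 0 < n ->
  ~ contains_subgraph G (join_IK m n) -> lc_inv G G' set0 k ->
  omega (induced G (Omega G)) + k <= m -> clique G' K -> #|K| < m + n.
Proof.
move=> n0 nIK [eV sG lk cl] om /cliqueP[sK aK]; rewrite setD0 in eV.
rewrite ltnNge; apply/negP=> big.
(* After removing at most [k] vertices, this part of [K] is a clique of [induced G (Omega G)]. *)
have Lm : #|K :&: Omega G| <= m.
  have [|S Sk /cliqueP[sL aL]] := cl (K :&: Omega G).
    apply/cliqueP; split; first exact: subset_trans (subsetIl _ _) sK.
    by move=> x y /setIP[xK _] /setIP[yK _]; apply: aK.
  apply: leq_trans om; rewrite -(cardsID S) addnC; apply: leq_add; last first.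
    by apply: leq_trans Sk; apply: subset_leq_card; apply: subsetIr.
  have inO x : x \in K :&: Omega G :\: S -> x \in Omega G by case/setDP=> /setIP[].
  apply: leq_omega; apply/cliqueP; split.
    by apply/subsetP=> x xL; rewrite in_setI inO // (subsetP sL).
  by move=> x y xL yL xy; rewrite adj_induced !inO // aL.
have [sN [uN szN subN]] : exists s, [/\ uniq s, size s = n & {subset s <= K :\: Omega G}].
  by apply/card_geqP; have := cardsID (Omega G) K; lia.
pose N := [set x in sN].
have cN : #|N| = n by rewrite /N cardsE -szN; apply/card_uniqP.
have NK : N \subset K by apply/subsetP=> x; rewrite inE => /subN/setDP[].
have [sM [uM szM subM]] : exists s, [/\ uniq s, size s = m & {subset s <= K :\: N}].
  by apply/card_geqP; have := cardsID N K; rewrite (setIidPr NK) cN; lia.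
have x0 : T by case: sN szN {uN subN N cN NK subM} n0 => [<-|x].
pose f (s : 'I_m + 'I_n) := match s with inl i => nth x0 sM i | inr j => nth x0 sN j end.
have fM i : f (inl i) \in K :\: N by apply: subM; apply: mem_nth; rewrite szM.
have fN' j : f (inr j) \in sN by apply: mem_nth; rewrite szN.
have fN j : f (inr j) \in N by rewrite inE.
have fK t : f t \in K.
  by case: t => [i|j]; [case/setDP: (fM i) | apply: (subsetP NK)].
(* For a vertex [x] on no hole, [linked G x x y] is adjacency in [G] by definition: no edge at [x]
   was added. *)
have join_adj j y : y \in K -> f (inr j) != y -> adj G (f (inr j)) y.
  move=> yK ny; set x := f (inr j) in ny *.
  have nh X : is_hole G X -> x \notin X.
    move=> hX; apply/negP=> xX; have /setDP[_ /negP] := subN _ (fN' j); apply.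
    by rewrite inE; apply/asboolP; exists X.
  have := lk x nh x y (aK _ _ (fK _) yK ny); by rewrite /linked eqxx.
have MN i j : f (inl i) != f (inr j).
  by case/setDP: (fM i) => _; apply: contraNneq => ->.
apply: nIK; exists f; split.
- move=> [i|j] [i'|j'] e.
  + by move/eqP: e; rewrite nth_uniq ?szM // => /eqP/val_inj->.
  + by have := MN i j'; rewrite e eqxx.
  + by have := MN i' j; rewrite e eqxx.
  + by move/eqP: e; rewrite nth_uniq ?szN // => /eqP/val_inj->.
- by move=> s; rewrite -eV; apply: (subsetP sK).
- move=> [i|j] [i'|j'] //= h; rewrite -/(f (inr _)) -?/(f (inl _)).
  + by rewrite adjC; apply: join_adj => //; rewrite eq_sym; apply: MN.
  + by apply: join_adj => //; rewrite eq_sym; apply: MN.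
  + by apply: join_adj; [apply: (fK (inr j')) | rewrite nth_uniq ?szN].
Qed.

End Graphs.

Theorem theorem4p7 (T : finType) (G : graph T) (m n : nat) :
  0 < n -> n <= m ->
  ~ chordal G ->
  ~ contains_subgraph G (join_IK m n) ->
  (exists k, nci G k /\ omega (induced G (Omega G)) + k <= m) ->
  (exists Gs : graph T, chordal_completion G Gs /\ omega Gs < m + n) /\
  (exists k, chiDP G k /\ k < m + n).
Proof.
move=> n0 nm nch nIK [k [hk km]].
case: hk => [[]//|[_ [C [[sC C0 _] [P [sP [[_ PC dis] ok]]]]] _]].
have [|||G' inv cG'] := @lcp_ok_completion T G (delete G C) P 0 _ _ dis _ ok.
- by rewrite PC; apply: lc_inv_delete.
- by rewrite PC.
- by move=> P0; rewrite -PC P0 big_nil eqxx in C0.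
rewrite add0n sP in inv.
have [eV sG _ _] := inv; rewrite setD0 in eV.
have {}sG x y : adj G x y -> adj G' x y.
  by move=> xy; apply: sG => //; rewrite eV (adj_gV xy).
(* The predecessor is the number of colours used below, which turns the strict clique bound into a
   strict bound on the DP-chromatic number. *)
have om : omega G' <= (m + n).-1.
  by apply/bigmax_leqP=> K /(lc_inv_clique n0 nIK inv km); lia.
split; first by exists G'; split=> //; lia.
have [j dpj lej] := chiDP_exists (dp_colorable_sub eV sG (chordal_dp_colorable cG' om)).
by exists j; split=> //; lia.
Qed.
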